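(* The homogeneous space $(E_{6,\mathbb{R}})^{\mathbb{C}}/(F_{4,\mathbb{R}})^{\mathbb{C}}$ is homeomorphic to the space $(EIV_{\mathbb{R}})^{\mathbb{C}}$: $(E_{6,\mathbb{R}})^{\mathbb{C}}/(F_{4,\mathbb{R}})^{\mathbb{C}}\simeq(EIV_{\mathbb{R}})^{\mathbb{C}}$. In particular, the group $(E_{6,\mathbb{R}})^{\mathbb{C}}$ is connected.
   Context: Let $(\mathfrak{J}_{\mathbb{R}})^{\mathbb{C}}$ be the space of symmetric $3\times 3$ complex matrices with $X\circ Y=\frac12(XY+YX)$ and the determinant $\det$. Let $(E_{6,\mathbb{R}})^{\mathbb{C}}=\{\alpha\in \mathrm{Iso}_{\mathbb{C}}((\mathfrak{J}_{\mathbb{R}})^{\mathbb{C}}) \mid \det(\alpha X)=\det X\ \forall X\}$ and $(F_{4,\mathbb{R}})^{\mathbb{C}}=\{\alpha\in \mathrm{Iso}_{\mathbb{C}}((\mathfrak{J}_{\mathbb{R}})^{\mathbb{C}}) \mid \alpha(X\circ Y)=\alpha X\circ\alpha Y\ \forall X,Y\}$, where $\mathrm{Iso}_{\mathbb{C}}(V)$ is the group of $\mathbb{C}$-linear automorphisms of $V$. The group $(F_{4,\mathbb{R}})^{\mathbb{C}}$ is regarded as a subgroup of $(E_{6,\mathbb{R}})^{\mathbb{C}}$, namely the subgroup of elements fixing the unit matrix $E$. Finally $(EIV_{\mathbb{R}})^{\mathbb{C}}=\{X\in(\mathfrak{J}_{\mathbb{R}})^{\mathbb{C}}\mid\det X=1\}$.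 *)

(* Defs.v *)
From HB Require Import structures.
From mathcomp Require Import all_boot all_order all_algebra.
From mathcomp Require Import all_classical all_reals all_analysis.

Set Implicit Arguments.
Unset Strict Implicit.
Unset Printing Implicit Defensive.

Import Order.TTheory GRing.Theory Num.Theory.
Import numFieldNormedType.Exports.

Local Open Scope classical_set_scope.
Local Open Scope ring_scope.

Definition homeomorphic (X Y : topologicalType) : Prop :=
  exists (f : X -> Y) (g : Y -> X),
    [/\ cancel f g, cancel g f, continuous f & continuous g].

(* The topology of the finite-dimensional space 'Hom(V, W): convergence of the
   matrix coefficients. [f2mx] uses the bases fixed by the [vectType]
   structures of V and W, but the topology does not depend on the bases. *)
HB.instance Definition _ (K : numFieldType) (V W : vectType K) :=
  Topological.copy 'Hom(V, W)
    (initial_topology (@VectorInternalTheory.f2mx K V W)).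

Section Sym3.
Variable K : numFieldType.

Definition symv : {vspace 'M[K]_3} := fixedSpace (linfun (@trmx K 3 3)).

Lemma mem_symv (X : 'M[K]_3) : (X \in symv) = (X^T == X).
Proof. by apply/fixedSpaceP/eqP; rewrite lfunE. Qed.

Definition J3 := subvs_of symv.
HB.instance Definition _ := Vector.on J3.
HB.instance Definition _ :=
  Topological.copy J3 (initial_topology (vsval : J3 -> 'M[K]_3)).

Fact jordan_subproof (X Y : J3) :
  2^-1 *: (vsval X *m vsval Y + vsval Y *m vsval X) \in symv.
Proof.
case: X Y => X /= + [Y /=]; rewrite !mem_symv => /eqP sX /eqP sY.
by rewrite linearZ linearD /= !trmx_mul sX sY addrC.
Qed.

Definition jordan (X Y : J3) : J3 := Subvs (jordan_subproof X Y).

Definition jdet (X : J3) : K := \det (vsval X).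

Definition E6 : set 'End(J3) :=
  [set f : 'End(J3) | bijective f /\ forall X, jdet (f X) = jdet X].

Definition F4 : set 'End(J3) :=
  [set f : 'End(J3) | bijective f /\ forall X Y, f (jordan X Y) = jordan (f X) (f Y)].

Definition EIV : set J3 := [set X | jdet X = 1].

Lemma F4_1 : F4 \1%VF.
Proof.
by split=> [|X Y]; rewrite ?id_lfunE //; exists id => X; rewrite id_lfunE.
Qed.

Lemma F4_comp f g : F4 f -> F4 g -> F4 (f \o g)%VF.
Proof.
move=> [bf mf] [bg mg]; split=> [|X Y]; last by rewrite !comp_lfunE mg mf.
by apply: (eq_bij (bij_comp bf bg)) => X; rewrite comp_lfunE.
Qed.

Lemma bij_lfunVK (f : 'End(J3)) : bijective f -> cancel f f^-1%VF.
Proof. by move=> [g fK gK]; exact/lker0_lfunK/lker0P/(can_inj fK). Qed.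

Lemma bij_lfunKV (f : 'End(J3)) : bijective f -> cancel f^-1%VF f.
Proof.
move=> bf X; have /bij_lfunVK fK := bf.
by case: bf => g _ gK; rewrite -{1}(gK X) fK gK.
Qed.

Lemma F4_inv f : F4 f -> F4 f^-1%VF.
Proof.
move=> [bf mf]; have fK := bij_lfunVK bf; have Kf := bij_lfunKV bf.
by split=> [|X Y]; [exists f | rewrite -{1}[X]Kf -{1}[Y]Kf -mf fK].
Qed.

(* [b] lies in the left coset [a F4]. As [a] and [b] are in E6, [c] is too. The
   type of [a] and [b] is the subset E6 of ['End(J3)] with its subspace
   topology. *)
Definition coset_eq (a b : E6) : bool :=
  `[< exists2 c, F4 c & set_val b = (set_val a \o c)%VF >].

Lemma coset_eq_equiv : equiv_class_of coset_eq.
Proof.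
split=> [a|a b|b a c].
- by apply/asboolP; exists \1%VF; [exact: F4_1 | rewrite comp_lfun1r].
- apply/asboolP/asboolP => -[f Ff ->];
    (exists f^-1%VF; first exact: F4_inv);
    rewrite -comp_lfunA (_ : (f \o f^-1)%VF = \1%VF) ?comp_lfun1r //;
    by apply/lfunP => X; rewrite comp_lfunE id_lfunE bij_lfunKV //; case: Ff.
- move=> /asboolP[f Ff eb] /asboolP[g Fg ec]; apply/asboolP.
  by exists (f \o g)%VF; [exact: F4_comp | rewrite ec eb comp_lfunA].
Qed.

Canonical coset_eq_equivRel := EquivRelPack coset_eq_equiv.

Definition E6modF4 := quotient_topology {eq_quot coset_eq}%qT.
HB.instance Definition _ := Topological.on E6modF4.

End Sym3.

Arguments E6 : clear implicits.
Arguments F4 : clear implicits.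
Arguments EIV : clear implicits.

(* Main.v *)
(* Write rho A for the map X |-> A X A^T. The heart of the matter is that the
   group of linear maps preserving det is exactly rho(SL_3). Let f preserve det.
   For a diagonal matrix unit e_i, det(Y + t e_i) is affine in t for every
   symmetric Y; so is det(Y + t f(e_i)), which makes all 2x2 minors of f(e_i)
   vanish, i.e. f(e_i) = v_i v_i^T. Let A have columns v_0, v_1, v_2. Then
   rho(A)^-1 f fixes each e_i, and comparing coefficients of
   det(diag(x, y, z) + M) shows that it is conjugation by a sign matrix.

   Consequently an element of the group fixing E is rho(A) with A A^T = 1, which
   is a Jordan automorphism, so the fibres of f |-> f(E) are the cosets of F4.
   This map is onto since every complex symmetric matrix is of the form A A^T.
   The inverse bijection is continuous since Cholesky decomposition gives, for Y
   near A A^T, a solution of B B^T = Y with B close to A. Finally SL_n is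
   connected: row and column operations along straight lines in SL_n reduce it
   to SL_(n-1). *)

Require Import Defs.
From HB Require Import structures.
From mathcomp Require Import all_boot all_order all_algebra.
From mathcomp Require Import all_classical all_reals all_analysis.
From mathcomp.real_closed Require Import complex.
From mathcomp Require Import perm ring.
Import Order.TTheory GRing.Theory Num.Theory.
Import numFieldNormedType.Exports.

Set Implicit Arguments.
Unset Strict Implicit.
Unset Printing Implicit Defensive.

Local Open Scope classical_set_scope.
Local Open Scope ring_scope.

(** * Symmetric matrices of size 3 in coordinates *)

Lemma ord3_ind (P : 'I_3 -> Prop) : P 0 -> P 1 -> P 2 -> forall i, P i.
Proof.
move=> P0 P1 P2 [[|[|[|//]]] lti].
- by rewrite (_ : Ordinal lti = 0) //; exact: val_inj.
- by rewrite (_ : Ordinal lti = 1) //; exact: val_inj.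
- by rewrite (_ : Ordinal lti = 2) //; exact: val_inj.
Qed.

Section Sym3Coordinates.
Variable K : numFieldType.
Implicit Types a b c p q r : K.

(** [a], [b], [c] are the diagonal entries; [p], [q], [r] stand opposite to them, in the positions
    (1,2), (0,2), (0,1). *)
Definition sym3 a b c p q r : 'M[K]_3 :=
  \matrix_(i, j)
    nth 0 (nth [::] [:: [:: a; r; q]; [:: r; b; p]; [:: q; p; c]] i) j.

Lemma tr_sym3 a b c p q r : (sym3 a b c p q r)^T = sym3 a b c p q r.
Proof. by apply/matrixP; elim/ord3_ind; elim/ord3_ind; rewrite !mxE. Qed.

Lemma sym3_coord (X : 'M[K]_3) : X^T = X ->
  X = sym3 (X 0 0) (X 1 1) (X 2 2) (X 1 2) (X 0 2) (X 0 1).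
Proof.
move=> sX; apply/matrixP; elim/ord3_ind; elim/ord3_ind;
  rewrite mxE //=; by rewrite -[in LHS]sX mxE.
Qed.

Lemma sym3D a b c p q r a' b' c' p' q' r' :
  sym3 a b c p q r + sym3 a' b' c' p' q' r' =
  sym3 (a + a') (b + b') (c + c') (p + p') (q + q') (r + r').
Proof. by apply/matrixP; elim/ord3_ind; elim/ord3_ind; rewrite !mxE. Qed.

Lemma sym3Z k a b c p q r :
  k *: sym3 a b c p q r = sym3 (k * a) (k * b) (k * c) (k * p) (k * q) (k * r).
Proof. by apply/matrixP; elim/ord3_ind; elim/ord3_ind; rewrite !mxE. Qed.

Lemma det_sym3 a b c p q r : \det (sym3 a b c p q r) =
  a * b * c + 2 * p * q * r - a * p ^+ 2 - b * q ^+ 2 - c * r ^+ 2.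
Proof.
rewrite (expand_det_row _ 0) !big_ord_recl big_ord0 /cofactor.
rewrite !(expand_det_row _ 0) !big_ord_recl !big_ord0 /cofactor !det_mx11.
rewrite !mxE /= /bump /=.
by ring.
Qed.

End Sym3Coordinates.

(** * Congruence by a matrix *)

Section CongruenceAction.
Variable K : numFieldType.
Implicit Types (A B : 'M[K]_3) (X Y : J3 K).

Lemma tr_J3 X : (vsval X)^T = vsval X.
Proof. by apply/eqP; rewrite -mem_symv subvsP. Qed.

(** A projection onto the symmetric matrices, hence linear and total; it returns [A] itself only for
    symmetric [A]. *)
Definition toJ3 A : J3 K := vsproj (symv K) A.

Lemma toJ3K A : A^T = A -> vsval (toJ3 A) = A.
Proof. by move=> sA; apply: vsprojK; rewrite mem_symv sA. Qed.

Lemma toJ3_vsval X : toJ3 (vsval X) = X.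
Proof. exact: vsvalK. Qed.

Lemma toJ3_sym3 X : exists a b c p q r, X = toJ3 (sym3 a b c p q r).
Proof.
exists (vsval X 0 0), (vsval X 1 1), (vsval X 2 2).
exists (vsval X 1 2), (vsval X 0 2), (vsval X 0 1).
by rewrite -sym3_coord ?toJ3_vsval ?tr_J3.
Qed.

Lemma tr_congr A B : B^T = B -> (A *m B *m A^T)^T = A *m B *m A^T.
Proof. by move=> sB; rewrite !trmx_mul sB trmxK mulmxA. Qed.

Definition rho A : 'End(J3 K) :=
  linfun (vsproj (symv K) \o mulmxr A^T \o mulmx A \o vsval).

Lemma rhoE A X : vsval (rho A X) = A *m vsval X *m A^T.
Proof. by rewrite lfunE /= -/(toJ3 _) toJ3K ?tr_congr ?tr_J3. Qed.

Lemma rhoM A B : rho (A *m B) = (rho A \o rho B)%VF.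
Proof.
apply/lfunP => X; apply: val_inj; rewrite comp_lfunE /=.
by rewrite !rhoE trmx_mul !mulmxA.
Qed.

Lemma rho1 : rho 1%:M = \1%VF.
Proof.
apply/lfunP => X; apply: val_inj; rewrite id_lfunE /= rhoE.
by rewrite trmx1 mulmx1 mul1mx.
Qed.

Lemma rhoN A : rho (- A) = rho A.
Proof.
apply/lfunP => X; apply: val_inj; rewrite /= !rhoE.
by rewrite linearN /= mulNmx mulmxN mulNmx opprK.
Qed.

Lemma rhoK A : A \in unitmx -> cancel (rho A) (rho (invmx A)).
Proof. by move=> uA X; rewrite -comp_lfunE -rhoM mulVmx // rho1 id_lfunE. Qed.

Lemma rhoVK A : A \in unitmx -> cancel (rho (invmx A)) (rho A).
Proof. by move=> uA X; rewrite -comp_lfunE -rhoM mulmxV // rho1 id_lfunE. Qed.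

Lemma unitmx_det_sqr n (A : 'M[K]_n) : \det A ^+ 2 = 1 -> A \in unitmx.
Proof.
move=> dA; rewrite unitmxE unitfE; apply/eqP => d0; move: dA.
by rewrite d0 expr0n /= => /esym/eqP; rewrite oner_eq0.
Qed.

Lemma jdet_rho A X : jdet (rho A X) = \det A ^+ 2 * jdet X.
Proof. by rewrite /jdet rhoE !det_mulmx det_tr; ring. Qed.

(** [rho A] multiplies det by the square of [\det A]. The value -1 does occur, for frames of columns
    and for roots [A] of a matrix [A *m A^T]. *)
Lemma E6_rho A : \det A ^+ 2 = 1 -> E6 K (rho A).
Proof.
move=> dA; have uA := unitmx_det_sqr dA.
split=> [|X]; last by rewrite jdet_rho dA mul1r.
by exists (rho (invmx A)); [exact: rhoK | exact: rhoVK].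
Qed.

Lemma E6_comp f g : E6 K f -> E6 K g -> E6 K (f \o g)%VF.
Proof.
move=> [bf df] [bg dg]; split=> [|X]; last by rewrite comp_lfunE df dg.
by apply: (eq_bij (bij_comp bf bg)) => X; rewrite comp_lfunE.
Qed.

Definition J3E : J3 K := toJ3 1%:M.

Lemma vsval_J3E : vsval J3E = 1%:M.
Proof. by rewrite toJ3K ?trmx1. Qed.

Lemma rho_J3E A : vsval (rho A J3E) = A *m A^T.
Proof. by rewrite rhoE vsval_J3E mulmx1. Qed.

Lemma jordan1l X : jordan J3E X = X.
Proof.
apply: val_inj; rewrite /= -/(J3E) vsval_J3E mul1mx mulmx1 -mulr2n.
by rewrite -[vsval X *+ 2]scaler_nat scalerA mulVf ?scale1r // pnatr_eq0.
Qed.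

Lemma jordanC X Y : jordan X Y = jordan Y X.
Proof. by apply: val_inj; rewrite /= addrC. Qed.

(** By surjectivity [f J3E] is again a unit of the Jordan product, and a commutative product has at
    most one unit. *)
Lemma F4_J3E f : F4 K f -> f J3E = J3E.
Proof.
move=> [bf mf]; have Kf := bij_lfunKV bf.
have unit_fE X : jordan (f J3E) X = X by rewrite -(Kf X) -mf jordan1l.
by rewrite -[LHS]jordan1l jordanC unit_fE.
Qed.

Lemma F4_rho A : \det A ^+ 2 = 1 -> rho A J3E = J3E -> F4 K (rho A).
Proof.
(* Fixing E means that [A] is orthogonal, so [rho A] is conjugation by [A] and respects matrix
   products. *)
move=> dA /(congr1 vsval); rewrite rho_J3E vsval_J3E => /mulmx1C AA.
split=> [|X Y]; first by have [] := E6_rho dA.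
apply: val_inj; rewrite /= rhoE /= !rhoE.
have AAK (M : 'M[K]_3) : M *m A^T *m A = M by rewrite -mulmxA AA mulmx1.
by rewrite -scalemxAr -scalemxAl mulmxDr mulmxDl !mulmxA !AAK.
Qed.

End CongruenceAction.

(** * Determinant preserving maps are congruences *)

Section E6Structure.
Variable K : numClosedFieldType.
Implicit Types (A B : 'M[K]_3) (X Y : J3 K).

(** The second difference of det at [Y] in direction [X] is twice the trace of [Y] times the
    adjugate of [X]. Since [Y] is arbitrary, the 2x2 minors of [X] vanish. *)
Lemma rank1_of_det (X : 'M[K]_3) : X^T = X ->
  (forall Y : 'M[K]_3, Y^T = Y -> \det (Y + X) + \det (Y - X) = 2 * \det Y) ->
  exists v : 'cV[K]_3, X = v *m v^T.
Proof.
move=> /sym3_coord.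
move: (X 0 0) (X 1 1) (X 2 2) (X 1 2) (X 0 2) (X 0 1) => a b c p q r -> dX.
have {}dX x y z s t u : a * b * z + a * c * y + b * c * x
    + 2 * (p * q * u + p * r * t + q * r * s)
    - (x * p ^+ 2 + y * q ^+ 2 + z * r ^+ 2)
    - 2 * (a * p * s + b * q * t + c * r * u) = 0.
  have := dX _ (tr_sym3 x y z s t u).
  rewrite -scaleN1r sym3Z !sym3D !det_sym3 => /eqP; rewrite -subr_eq0 => /eqP d0.
  have n2 : (2 : K) != 0 by rewrite pnatr_eq0.
  by apply: (mulfI n2); rewrite mulr0 -[RHS]d0; ring.
have n2 : (2 : K) != 0 by rewrite pnatr_eq0.
(* Each choice of [Y] as a symmetric matrix unit isolates one minor. *)
have bc : b * c = p ^+ 2.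
  by apply/subr0_eq; rewrite -(dX 1 0 0 0 0 0); ring.
have ac : a * c = q ^+ 2.
  by apply/subr0_eq; rewrite -(dX 0 1 0 0 0 0); ring.
have ab : a * b = r ^+ 2.
  by apply/subr0_eq; rewrite -(dX 0 0 1 0 0 0); ring.
have qr : q * r = a * p.
  by apply/(mulfI n2)/subr0_eq; rewrite -(dX 0 0 0 1 0 0); ring.
have rankE x y z : a = x * x -> b = y * y -> c = z * z -> p = y * z ->
    q = x * z -> r = x * y ->
    exists v : 'cV[K]_3, sym3 a b c p q r = v *m v^T.
  move=> -> -> -> -> -> ->; exists (\col_i nth 0 [:: x; y; z] i).
  by apply/matrixP; elim/ord3_ind; elim/ord3_ind;
    rewrite !mxE big_ord1 !mxE //= mulrC.
(* If [a] is nonzero, [v] is the first column divided by a root of [a]. Otherwise [q] and [r] vanish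
   too, and the same argument runs on the block of [b], [c], [p]. *)
have [a0|a0] := eqVneq a 0.
  have q0 : q = 0 by apply/eqP; rewrite -sqrf_eq0 -ac a0 mul0r.
  have r0 : r = 0 by apply/eqP; rewrite -sqrf_eq0 -ab a0 mul0r.
  have [b0|b0] := eqVneq b 0.
    have p0 : p = 0 by apply/eqP; rewrite -sqrf_eq0 -bc b0 mul0r.
    by apply: (rankE 0 0 (sqrtC c)); rewrite ?mul0r -?expr2 ?sqrtCK.
  have sb : sqrtC b != 0 by rewrite sqrtC_eq0.
  apply: (rankE 0 (sqrtC b) (p / sqrtC b)); rewrite ?mul0r -?expr2 ?sqrtCK //.
  - by rewrite expr_div_n sqrtCK -bc [b * c]mulrC mulfK.
  - by rewrite mulrCA mulfV ?mulr1.
have sa : sqrtC a != 0 by rewrite sqrtC_eq0.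
apply: (rankE (sqrtC a) (r / sqrtC a) (q / sqrtC a)).
- by rewrite -expr2 sqrtCK.
- by rewrite -expr2 expr_div_n sqrtCK -ab [a * b]mulrC mulfK.
- by rewrite -expr2 expr_div_n sqrtCK -ac [a * c]mulrC mulfK.
- by rewrite mulf_div -expr2 sqrtCK [r * q]mulrC qr [a * p]mulrC mulfK.
- by rewrite mulrCA mulfV ?mulr1.
- by rewrite mulrCA mulfV ?mulr1.
Qed.

(** The two sides are the determinants of diag(x, y, z) + M and of diag(x, y, z) +
    [sym3 0 0 0 1 0 0]. Finite differences over the points 0 and 1 isolate the coefficients. *)
Lemma cubic_coeffs (a b c p q r : K) :
  (forall x y z, (x + a) * (y + b) * (z + c) + 2 * p * q * r
     - (x + a) * p ^+ 2 - (y + b) * q ^+ 2 - (z + c) * r ^+ 2 = x * y * z - x) ->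
  [/\ [/\ a = 0, b = 0 & c = 0], p ^+ 2 = 1, q = 0 & r = 0].
Proof.
move=> H; pose h x y z := (x + a) * (y + b) * (z + c) + 2 * p * q * r
  - (x + a) * p ^+ 2 - (y + b) * q ^+ 2 - (z + c) * r ^+ 2 - (x * y * z - x).
have {}H x y z : h x y z = 0 by apply/eqP; rewrite subr_eq0 H.
have c0 : c = 0.
  transitivity (h 1 1 0 - h 1 0 0 - h 0 1 0 + h 0 0 0); first by rewrite /h; ring.
  by rewrite !H !subr0 addr0.
have b0 : b = 0.
  transitivity (h 1 0 1 - h 1 0 0 - h 0 0 1 + h 0 0 0); first by rewrite /h; ring.
  by rewrite !H !subr0 addr0.
have a0 : a = 0.
  transitivity (h 0 1 1 - h 0 1 0 - h 0 0 1 + h 0 0 0); first by rewrite /h; ring.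
  by rewrite !H !subr0 addr0.
split=> //.
- apply/esym/subr0_eq; transitivity (h 1 0 0 - h 0 0 0).
    by rewrite /h a0 b0 c0; ring.
  by rewrite !H subr0.
- apply/eqP; rewrite -sqrf_eq0; apply/eqP; transitivity (h 0 0 0 - h 0 1 0).
    by rewrite /h a0 b0 c0; ring.
  by rewrite !H subr0.
- apply/eqP; rewrite -sqrf_eq0; apply/eqP; transitivity (h 0 0 0 - h 0 0 1).
    by rewrite /h a0 b0 c0; ring.
  by rewrite !H subr0.
Qed.

Lemma sym3_diag_congr (x y z a b c p q r : K) :
  sym3 x y z 0 0 0 *m sym3 a b c p q r *m sym3 x y z 0 0 0 =
  sym3 (x ^+ 2 * a) (y ^+ 2 * b) (z ^+ 2 * c)
       (y * z * p) (x * z * q) (x * y * r).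
Proof.
apply/matrixP; elim/ord3_ind; elim/ord3_ind;
  rewrite !mxE !big_ord_recl !big_ord0 !mxE !big_ord_recl !big_ord0 !mxE /=;
  by ring.
Qed.

Lemma E6_fix_diag (g : 'End(J3 K)) : E6 K g ->
    (forall i, g (toJ3 (delta_mx i i)) = toJ3 (delta_mx i i)) ->
  exists2 S, \det S = 1 & g = rho S.
Proof.
move=> [_ dg] gd.
have toJ3_diag x y z : toJ3 (sym3 x y z 0 0 0) = x *: toJ3 (delta_mx 0 0) +
    y *: toJ3 (delta_mx 1 1) + z *: toJ3 (delta_mx 2 2) :> J3 K.
  rewrite -!linearZ -!linearD /=; congr (toJ3 _); apply/matrixP.
  by elim/ord3_ind; elim/ord3_ind; rewrite !mxE /= ?mulr0 ?mulr1 ?add0r ?addr0.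
have gdiag x y z : g (toJ3 (sym3 x y z 0 0 0)) = toJ3 (sym3 x y z 0 0 0).
  by rewrite toJ3_diag !linearD !linearZ /= !gd.
have jdet_diag x y z X : jdet (g X + toJ3 (sym3 x y z 0 0 0)) =
    jdet (X + toJ3 (sym3 x y z 0 0 0)) by rewrite -[RHS]dg linearD /= gdiag.
(* Adding diagonal matrices, which [g] fixes, probes the image of an off-diagonal matrix through its
   determinants. *)
have gE p q r : exists a' b' c' p' q' r',
    g (toJ3 (sym3 0 0 0 p q r)) = toJ3 (sym3 a' b' c' p' q' r') /\
    forall x y z,
      (x + a') * (y + b') * (z + c') + 2 * p' * q' * r' - (x + a') * p' ^+ 2
        - (y + b') * q' ^+ 2 - (z + c') * r' ^+ 2 =
      x * y * z + 2 * p * q * r - x * p ^+ 2 - y * q ^+ 2 - z * r ^+ 2.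
  have [a' [b' [c' [p' [q' [r' e]]]]]] := toJ3_sym3 (g (toJ3 (sym3 0 0 0 p q r))).
  exists a', b', c', p', q', r'; split=> // x y z.
  have := jdet_diag x y z (toJ3 (sym3 0 0 0 p q r)).
  rewrite e -!linearD /jdet /= !toJ3K ?sym3D ?tr_sym3 // !det_sym3.
  by rewrite !addr0 !add0r ![_ + x]addrC ![_ + y]addrC ![_ + z]addrC => ->.
have [e0 e0_1 g0] : exists2 e, e ^+ 2 = 1 &
    g (toJ3 (sym3 0 0 0 1 0 0)) = toJ3 (sym3 0 0 0 e 0 0).
  have [a [b [c [p [q [r [-> H]]]]]]] := gE 1 0 0.
  have [|[-> -> ->] p1 -> ->] := @cubic_coeffs a b c p q r; last by exists p.
  by move=> x y z; rewrite H; ring.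
(* The other two cases follow from [cubic_coeffs] after exchanging the index 0 with 1, respectively
   with 2. *)
have [e1 e1_1 g1] : exists2 e, e ^+ 2 = 1 &
    g (toJ3 (sym3 0 0 0 0 1 0)) = toJ3 (sym3 0 0 0 0 e 0).
  have [a [b [c [p [q [r [-> H]]]]]]] := gE 0 1 0.
  have [|[-> -> ->] p1 -> ->] := @cubic_coeffs b a c q p r; last by exists q.
  by move=> y x z; have := H x y z => /eqP; rewrite -subr_eq0 => /eqP h0;
    apply/subr0_eq; rewrite -h0; ring.
have [e2 e2_1 g2] : exists2 e, e ^+ 2 = 1 &
    g (toJ3 (sym3 0 0 0 0 0 1)) = toJ3 (sym3 0 0 0 0 0 e).
  have [a [b [c [p [q [r [-> H]]]]]]] := gE 0 0 1.
  have [|[-> -> ->] p1 -> ->] := @cubic_coeffs c b a r q p; last by exists r.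
  by move=> z y x; have := H x y z => /eqP; rewrite -subr_eq0 => /eqP h0;
    apply/subr0_eq; rewrite -h0; ring.
have gsym a b c p q r : g (toJ3 (sym3 a b c p q r)) =
    toJ3 (sym3 a b c (e0 * p) (e1 * q) (e2 * r)).
  have -> : sym3 a b c p q r = sym3 a b c 0 0 0 + p *: sym3 0 0 0 1 0 0 +
      q *: sym3 0 0 0 0 1 0 + r *: sym3 0 0 0 0 0 1.
    by rewrite !sym3Z !sym3D !mulr0 !mulr1 !add0r !addr0.
  rewrite [in LHS]/toJ3 !linearD !linearZ /= gdiag g0 g1 g2.
  rewrite /toJ3 -!linearZ -!linearD /=; congr vsproj.
  rewrite !sym3Z !sym3D !mulr0 !add0r !addr0.
  by rewrite [p * _]mulrC [q * _]mulrC [r * _]mulrC.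
(* The matrix with zero diagonal and ones elsewhere has determinant 2; its image has determinant
   [2 * e0 * e1 * e2]. *)
have e012 : e0 * e1 * e2 = 1.
  have := dg (toJ3 (sym3 0 0 0 1 1 1)).
  rewrite gsym /jdet !toJ3K ?tr_sym3 // !det_sym3 !mul0r !subr0 !add0r !mulr1.
  have n2 : (2 : K) != 0 by rewrite pnatr_eq0.
  by move=> e; apply: (mulfI n2); rewrite mulr1 -[RHS]e !mulrA.
(* Conjugation by diag(e0, e1, e2) multiplies the entry [p] by [e1 * e2], which equals [e0] because
   the three signs have product 1; likewise for [q] and [r]. *)
exists (sym3 e0 e1 e2 0 0 0).
  by rewrite det_sym3 -e012; ring.
have e12 : e1 * e2 = e0.
  transitivity (e0 * e1 * e2 * e0); last by rewrite e012 mul1r.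
  by rewrite -[LHS]mul1r -e0_1; ring.
have e02 : e0 * e2 = e1.
  transitivity (e0 * e1 * e2 * e1); last by rewrite e012 mul1r.
  by rewrite -[LHS]mul1r -e1_1; ring.
have e01 : e0 * e1 = e2.
  transitivity (e0 * e1 * e2 * e2); last by rewrite e012 mul1r.
  by rewrite -[LHS]mul1r -e2_1; ring.
apply/lfunP => X; have [a [b [c [p [q [r ->]]]]]] := toJ3_sym3 X.
apply: val_inj; rewrite /= rhoE gsym !toJ3K ?tr_sym3 //.
by rewrite sym3_diag_congr e0_1 e1_1 e2_1 e12 e02 e01 !mul1r.
Qed.

Lemma E6_frame (f : 'End(J3 K)) : E6 K f ->
  exists A, forall i, f (toJ3 (delta_mx i i)) = rho A (toJ3 (delta_mx i i)).
Proof.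
move=> [bf df]; have Kf := bij_lfunKV bf.
have tr_delta i : (delta_mx i i : 'M[K]_3)^T = delta_mx i i by rewrite trmx_delta.
(* These vanishing products of diagonal entries kill the second difference of det along a diagonal
   matrix unit. *)
have delta_sym3 i : exists a b c : K,
    delta_mx i i = sym3 a b c 0 0 0 /\ a * b = 0 /\ a * c = 0 /\ b * c = 0.
  elim/ord3_ind: i; [exists 1, 0, 0|exists 0, 1, 0|exists 0, 0, 1];
    rewrite !(mulr0, mul0r); split=> //;
    by apply/matrixP; elim/ord3_ind; elim/ord3_ind; rewrite !mxE.
have rank1 i : exists v : 'cV[K]_3,
    vsval (f (toJ3 (delta_mx i i))) = v *m v^T.
  apply: rank1_of_det; first exact: tr_J3.
  move=> Y sY; set X := toJ3 (delta_mx i i).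
  (* Pulling [Y] back by [f] turns the second difference along [f X] into one along [X]. *)
  pose Z := f^-1%VF (toJ3 Y).
  have -> : Y = vsval (f Z) by rewrite Kf toJ3K.
  have -> : vsval (f Z) + vsval (f X) = vsval (f (Z + X)) by rewrite linearD.
  have -> : vsval (f Z) - vsval (f X) = vsval (f (Z - X)) by rewrite linearB.
  rewrite -!/(jdet _) !df /jdet [vsval (Z + X)]raddfD [vsval (Z - X)]raddfB /=.
  have [x [y [z [p [q [r ->]]]]]] := toJ3_sym3 Z.
  rewrite /X !toJ3K ?tr_sym3 //.
  have [a [b [c [-> [ab [ac bc]]]]]] := delta_sym3 i.
  rewrite -scaleN1r sym3Z !sym3D !det_sym3; apply/subr0_eq.
  transitivity (2 * (x * (b * c) + y * (a * c) + z * (a * b))); first by ring.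
  by rewrite ab ac bc !mulr0 !addr0 mulr0.
have [v vE] := fin_all_exists rank1.
(* The columns of this matrix are the vectors [v j], so it sends the i-th unit vector to [v i]. *)
exists (\matrix_(i, j) v j i 0) => i; apply: val_inj.
rewrite /= vE rhoE toJ3K //; apply/matrixP => k l.
rewrite !mxE big_ord1 (bigD1 i) //= big1 ?addr0 => [|j ji].
  rewrite !mxE (bigD1 i) //= big1 ?addr0 ?mxE ?eqxx ?mulr1 // => j ji.
  by rewrite !mxE (negPf ji) mulr0.
rewrite !mxE big1 ?mul0r // => m _.
by rewrite !mxE (negPf ji) andbF mulr0.
Qed.

Lemma E6_SL3 (f : 'End(J3 K)) : E6 K f -> exists2 A, \det A = 1 & f = rho A.
Proof.
move=> Ef; have [A fA] := E6_frame Ef.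
(* [f] and [rho A] agree on E, the sum of the frame; comparing determinants there gives the
   claim. *)
have dA : \det A ^+ 2 = 1.
  have eE : J3E K = \sum_i toJ3 (delta_mx i i).
    rewrite /J3E /toJ3 -linear_sum /=; congr vsproj; apply/matrixP => i j.
    rewrite summxE (bigD1 i) //= big1 ?addr0 ?mxE ?eqxx //= => [|k ki].
      by rewrite eq_sym.
    by rewrite mxE eq_sym (negPf ki).
  have fE : f (J3E K) = rho A (J3E K).
    by rewrite eE !linear_sum; apply: eq_bigr => i _; exact: fA.
  have [_ /(_ (J3E K))] := Ef.
  by rewrite fE jdet_rho /jdet vsval_J3E det1 mulr1.
have uA := unitmx_det_sqr dA.
have Eg : E6 K (rho (invmx A) \o f)%VF.
  by apply: E6_comp Ef; apply: E6_rho; rewrite det_inv exprVn dA invr1.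
have [|S dS gS] := E6_fix_diag Eg.
  by move=> i; rewrite comp_lfunE fA rhoK.
have fAS : f = rho (A *m S).
  apply/lfunP => X; rewrite rhoM -gS !comp_lfunE /= rhoVK //.
(* The size 3 is odd: determinant -1 is repaired by passing to the opposite matrix, which has the
   same [rho]. *)
have /orP[/eqP d1|/eqP dN1] : (\det A == 1) || (\det A == -1).
  by rewrite -eqf_sqr dA expr1n.
- by exists (A *m S) => //; rewrite det_mulmx d1 dS mulr1.
- exists (- (A *m S)); last by rewrite rhoN.
  by rewrite -scaleN1r detZ det_mulmx dN1 dS; ring.
Qed.

Lemma E6_stab_F4 (f : 'End(J3 K)) : E6 K f -> f (J3E K) = J3E K -> F4 K f.
Proof.
move=> /E6_SL3[A dA ->]; apply: F4_rho; by rewrite dA expr1n.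
Qed.

End E6Structure.

(** * Convergence of matrices *)

(* Fixing the filter to be [nbhs x] keeps unification from unfolding it. *)
Lemma cvg_cst_nbhs (T U : topologicalType) (x : T) (y : U) : y @[_ --> x] --> y.
Proof. exact: cvg_cst. Qed.

Section MatrixTopology.
Variable K : numFieldType.

Lemma cvgV_nbhs (T : topologicalType) (f : T -> K) (x : T) (a : K) :
  a != 0 -> f t @[t --> x] --> a -> (f t)^-1 @[t --> x] --> a^-1.
Proof. by move=> a0 cf; exact: cvgV. Qed.

(** A neighbourhood of a matrix contains a product of neighbourhoods of its finitely many
    entries. *)
Lemma cvg_mx (T U : topologicalType) m n (f : T -> 'M[U]_(m, n)) (x : T)
    (M : 'M[U]_(m, n)) :
  (forall i j, f t i j @[t --> x] --> M i j) -> f t @[t --> x] --> M.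
Proof.
move=> cf A [P Pnb sPA]; apply: filterS; first exact: sPA.
by apply: filter_forall => i; apply: filter_forall => j; exact: cf.
Qed.

Lemma cvg_coord m n (T : topologicalType) (f : T -> 'M[K]_(m, n)) (x : T)
    (M : 'M[K]_(m, n)) i j :
  f t @[t --> x] --> M -> f t i j @[t --> x] --> M i j.
Proof. by move=> cf; exact: (continuous_cvg _ (@coord_continuous K m n i j M)). Qed.

Lemma cvg_sum (T : topologicalType) (I : Type) (s : seq I) (F : I -> T -> K)
    (a : I -> K) (x : T) :
  (forall i, F i t @[t --> x] --> a i) ->
  (\sum_(i <- s) F i t) @[t --> x] --> \sum_(i <- s) a i.
Proof.
by move=> cF; apply: cvg_big => //; exact: add_continuous.
Qed.

Lemma cvg_mulmx m n p (T : topologicalType) (f : T -> 'M[K]_(m, n))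
    (g : T -> 'M[K]_(n, p)) (x : T)
    (M : 'M[K]_(m, n)) (N : 'M[K]_(n, p)) :
  f t @[t --> x] --> M -> g t @[t --> x] --> N ->
  f t *m g t @[t --> x] --> M *m N.
Proof.
move=> cf cg; apply: cvg_mx => i j; rewrite mxE.
under eq_fun do rewrite mxE.
by apply: cvg_sum => k; apply: cvgM; exact: cvg_coord.
Qed.

Lemma cvg_trmx m n (T : topologicalType) (f : T -> 'M[K]_(m, n)) (x : T)
    (M : 'M[K]_(m, n)) :
  f t @[t --> x] --> M -> (f t)^T @[t --> x] --> M^T.
Proof.
move=> cf; apply: cvg_mx => i j; rewrite mxE.
by under eq_fun do rewrite mxE; exact: cvg_coord.
Qed.

Lemma cvg_linear_mx m n p q (T : topologicalType)
    (f : 'M[K]_(m, n) -> 'M[K]_(p, q)) (g : T -> 'M[K]_(m, n)) (x : T)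
    (M : 'M[K]_(m, n)) : linear f ->
  g t @[t --> x] --> M -> f (g t) @[t --> x] --> f M.
Proof.
move=> linf.
pose F : {linear _ -> _} := HB.pack f (GRing.isLinear.Build _ _ _ _ f linf).
(* Expanding in matrix units makes the entries of [f N] finite linear combinations of those of
   [N]. *)
have fE N i j : f N i j = \sum_k \sum_l N k l * f (delta_mx k l) i j.
  rewrite -[f]/(F : _ -> _) {1}[N]matrix_sum_delta linear_sum summxE.
  apply: eq_bigr => k _; rewrite linear_sum summxE; apply: eq_bigr => l _.
  by rewrite linearZ mxE.
move=> cg; apply: cvg_mx => i j; rewrite fE; under eq_fun do rewrite fE.
apply: cvg_sum => k; apply: cvg_sum => l; apply: cvgM; last exact: cvg_cst.
exact: cvg_coord.
Qed.

Lemma cvg_block_mx m1 m2 n1 n2 (T : topologicalType) (x : T)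
    (f : T -> 'M[K]_(m1, n1)) (g : T -> 'M[K]_(m1, n2))
    (h : T -> 'M[K]_(m2, n1)) (k : T -> 'M[K]_(m2, n2)) 
    (A : 'M[K]_(m1, n1)) (B : 'M[K]_(m1, n2))
    (C : 'M[K]_(m2, n1)) (D : 'M[K]_(m2, n2)) :
  f t @[t --> x] --> A -> g t @[t --> x] --> B ->
  h t @[t --> x] --> C -> k t @[t --> x] --> D ->
  block_mx (f t) (g t) (h t) (k t) @[t --> x] --> block_mx A B C D.
Proof.
move=> cf cg ch ck; apply: cvg_mx => i j.
rewrite -(splitK i) -(splitK j); case: (fintype.split i) => i' /=;
  case: (fintype.split j) => j' /=.
- by rewrite block_mxEul; under eq_fun do rewrite block_mxEul; exact: cvg_coord.
- by rewrite block_mxEur; under eq_fun do rewrite block_mxEur; exact: cvg_coord.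
- by rewrite block_mxEdl; under eq_fun do rewrite block_mxEdl; exact: cvg_coord.
- by rewrite block_mxEdr; under eq_fun do rewrite block_mxEdr; exact: cvg_coord.
Qed.

Lemma cvg_scale_mx m n (T : topologicalType) (f : T -> K)
    (g : T -> 'M[K]_(m, n)) (x : T) (a : K)
    (M : 'M[K]_(m, n)) :
  f t @[t --> x] --> a -> g t @[t --> x] --> M ->
  f t *: g t @[t --> x] --> a *: M.
Proof.
move=> cf cg; apply: cvg_mx => i j; rewrite mxE; under eq_fun do rewrite mxE.
by apply: cvgM => //; exact: cvg_coord.
Qed.

Lemma cvg_add_mx m n (T : topologicalType) (f g : T -> 'M[K]_(m, n)) (x : T)
    (M N : 'M[K]_(m, n)) :
  f t @[t --> x] --> M -> g t @[t --> x] --> N ->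
  f t + g t @[t --> x] --> M + N.
Proof.
move=> cf cg; apply: cvg_mx => i j; rewrite mxE; under eq_fun do rewrite mxE.
by apply: cvgD => //; exact: cvg_coord.
Qed.

Lemma cvg_sub_mx m n (T : topologicalType) (f g : T -> 'M[K]_(m, n)) (x : T)
    (M N : 'M[K]_(m, n)) :
  f t @[t --> x] --> M -> g t @[t --> x] --> N ->
  f t - g t @[t --> x] --> M - N.
Proof.
move=> cf cg; apply: cvg_mx => i j; rewrite !mxE; under eq_fun do rewrite !mxE.
by apply: cvgB; exact: cvg_coord.
Qed.

Lemma cvg_mxsub m n m' n' (T : topologicalType) (f : T -> 'M[K]_(m, n)) (x : T)
    (M : 'M[K]_(m, n)) (g : 'I_m' -> 'I_m) (h : 'I_n' -> 'I_n) :
  f t @[t --> x] --> M -> mxsub g h (f t) @[t --> x] --> mxsub g h M.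
Proof.
move=> cf; apply: cvg_mx => i j; rewrite mxE; under eq_fun do rewrite mxE.
exact: cvg_coord.
Qed.

End MatrixTopology.

(** * Connectedness of the special linear group *)

Section SpecialLinear.
Variable K : numFieldType.

Definition SL n : set 'M[K]_n := [set A | \det A = 1].

Hypothesis connectedK : connected [set: K].

(** The line through [A] in direction [N] is a continuous image of [K] inside SL that joins both
    points. *)
Lemma component_SL_line n (A N : 'M[K]_n) :
  (forall t, \det (A + t *: N) = 1) -> connected_component (@SL n) A (A + N).
Proof.
move=> detAN; pose line t := A + t *: N.
have cl : continuous line.
  move=> t; apply: cvg_add_mx; first exact: cvg_cst_nbhs.
  by apply: cvg_scale_mx; [exact: cvg_id | exact: cvg_cst_nbhs].
apply: (@connected_component_max _ _ (line @` setT)).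
- by exists 0 => //; rewrite /line scale0r addr0.
- by move=> _ [t _ <-]; exact: detAN.
- apply: connected_continuous_connected connectedK _.
  exact: continuous_subspaceT.
- by exists 1 => //; rewrite /line scale1r.
Qed.

Lemma component_SL_mull n (A N : 'M[K]_n) : SL A ->
  (forall t, \det (1%:M + t *: N) = 1) ->
  connected_component (@SL n) A ((1%:M + N) *m A).
Proof.
move=> dA dN; rewrite mulmxDl mul1mx; apply: component_SL_line => t.
by rewrite scalemxAl -{1}[A]mul1mx -mulmxDl det_mulmx dN dA mulr1.
Qed.

Lemma component_SL_mulr n (A N : 'M[K]_n) : SL A ->
  (forall t, \det (1%:M + t *: N) = 1) ->
  connected_component (@SL n) A (A *m (1%:M + N)).
Proof.
move=> dA dN; rewrite mulmxDr mulmx1; apply: component_SL_line => t.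
by rewrite scalemxAr -{1}[A]mulmx1 -mulmxDr det_mulmx dN dA mulr1.
Qed.

Lemma ublock_unip n (u : 'rV[K]_n) :
  block_mx 1%:M u 0 1%:M = 1%:M + block_mx 0 u 0 0 :> 'M[K]_(1 + n).
Proof. by rewrite (@scalar_mx_block _ 1 n) add_block_mx !addr0 add0r. Qed.

Lemma lblock_unip n (u : 'cV[K]_n) :
  block_mx 1%:M 0 u 1%:M = 1%:M + block_mx 0 0 u 0 :> 'M[K]_(1 + n).
Proof. by rewrite (@scalar_mx_block _ 1 n) add_block_mx !addr0 add0r. Qed.

Lemma det_ublock_unip n (u : 'rV[K]_n) t :
  \det (1%:M + t *: block_mx 0 u 0 0 : 'M[K]_(1 + n)) = 1.
Proof.
by rewrite scale_block_mx !scaler0 -ublock_unip det_ublock !det1 mulr1.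
Qed.

Lemma det_lblock_unip n (u : 'cV[K]_n) t :
  \det (1%:M + t *: block_mx 0 0 u 0 : 'M[K]_(1 + n)) = 1.
Proof.
by rewrite scale_block_mx !scaler0 -lblock_unip det_lblock !det1 mulr1.
Qed.

Lemma component_SL_pivot n (A : 'M[K]_(1 + n)) : SL A ->
  exists2 B, connected_component (@SL (1 + n)) A B & ulsubmx B = 1%:M.
Proof.
move=> dA.
(* Given a nonzero entry below the corner, a multiple of its row is added to the first row to make
   the corner 1. *)
have pivot (B : 'M[K]_(1 + n)) k : SL B -> dlsubmx B k 0 != 0 ->
    exists2 C, connected_component (@SL (1 + n)) B C & ulsubmx C = 1%:M.
  move=> dB Bk.
  pose u : 'rV[K]_n := ((1 - ulsubmx B 0 0) / dlsubmx B k 0) *: delta_mx 0 k.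
  exists ((1%:M + block_mx 0 u 0 0) *m B).
    by apply: component_SL_mull => // t; exact: det_ublock_unip.
  rewrite -ublock_unip -[B in _ *m B]submxK mulmx_block block_mxKul mul1mx.
  rewrite /u -scalemxAl -rowE {u}; move: (ulsubmx B) (dlsubmx B) Bk => a c ck.
  by apply/matrixP => i j; rewrite !ord1 !mxE divfK // subrKC.
have [[k Ak]|A0] := pselect (exists k, dlsubmx A k 0 != 0); first exact: pivot Ak.
have {}A0 : dlsubmx A = 0.
  apply/matrixP => i j; rewrite ord1 [RHS]mxE; apply/eqP/negPn/negP => Ai.
  by apply: A0; exists i.
have a0 : ulsubmx A 0 0 != 0.
  apply/eqP => a0; move: dA; rewrite /SL /= -[A]submxK A0 det_ublock det_mx11 a0.
  by rewrite mul0r => /esym/eqP; rewrite oner_eq0.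
(* For size 1 the corner is the determinant itself. *)
case: n => [|n] in A pivot dA A0 a0 *.
  exists A; first exact: connected_component_refl.
  move: dA; rewrite /SL /= -{1}[A]submxK A0 det_ublock det_mx00 mulr1 det_mx11.
  by move=> a1; apply/matrixP => i j; rewrite !ord1 a1 [RHS]mxE.
(* When only the corner is nonzero in the first column, adding the first row to the second creates
   the entry that [pivot] needs. *)
pose A' := (1%:M + block_mx 0 0 (delta_mx 0 0) 0) *m A.
have AA' : connected_component (@SL (1 + n.+1)) A A'.
  by apply: component_SL_mull => // t; exact: det_lblock_unip.
have [||B A'B B1] := pivot A' 0.
- exact: connected_component_sub AA'.
- rewrite /A' -lblock_unip -[A in _ *m A]submxK mulmx_block A0 block_mxKdl.
  by rewrite mulmx0 addr0 mxE big_ord1 mxE !eqxx mul1r.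
- by exists B => //; exact: connected_component_trans AA' A'B.
Qed.

Lemma connected_SL n : connected (@SL n).
Proof.
elim: n => [|n IHn].
  have -> : @SL 0 = [set 1%:M]; last exact: connected1.
  apply/seteqP; split=> A _; last by rewrite /SL /= det_mx00.
  by rewrite /= [A]flatmx0 [1%:M]flatmx0.
suff cc1 A : @SL (1 + n) A -> connected_component (@SL (1 + n)) 1%:M A.
  rewrite (_ : SL (n := n.+1) = connected_component (@SL (1 + n)) 1%:M).
    exact: component_connected.
  apply/seteqP; split; first exact: cc1.
  exact: connected_component_sub.
move=> /component_SL_pivot[B AB B1]; apply: connected_component_sym.
have dB : @SL (1 + n) B by exact: connected_component_sub AB.
apply: connected_component_trans AB _.
(* With corner 1, row operations clear [c], then column operations clear [r], which leaves the Schur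
   complement [D]. *)
pose c := dlsubmx B; pose r := ursubmx B; pose D := drsubmx B - c *m r.
pose B' := (1%:M + block_mx 0 0 (- c) 0) *m B.
have BB' : connected_component (@SL (1 + n)) B B'.
  by apply: component_SL_mull => // t; exact: det_lblock_unip.
have B'E : B' = block_mx 1%:M r 0 D.
  rewrite /B' -lblock_unip -[B in _ *m B]submxK mulmx_block B1 !mul1mx !mul0mx.
  by rewrite !addr0 mulmx1 mulNmx addNr addrC.
have dB' : @SL (1 + n) B' by exact: connected_component_sub BB'.
have B'B'' : connected_component (@SL (1 + n)) B' (block_mx 1%:M 0 0 D).
  have -> : block_mx 1%:M 0 0 D = B' *m (1%:M + block_mx 0 (- r) 0 0).
    rewrite B'E -ublock_unip mulmx_block !mulmx0 !mul0mx !mulmx1 !addr0 add0r.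
    by rewrite mul1mx addNr.
  by apply: component_SL_mulr => // t; exact: det_ublock_unip.
apply: connected_component_trans BB' _; apply: connected_component_trans B'B'' _.
have dD : SL D by move: dB'; rewrite /SL /= B'E det_ublock det1 mul1r.
pose diag1 (C : 'M[K]_n) : 'M[K]_(1 + n) := block_mx 1%:M 0 0 C.
(* The image of the smaller group is connected by induction and contains both the identity and
   diag(1, D). *)
apply: (@connected_component_max _ _ (diag1 @` @SL n)).
- by exists D.
- by move=> _ [C dC <-]; rewrite /SL /= det_ublock det1 mul1r.
- apply: connected_continuous_connected IHn _; apply: continuous_subspaceT.
  by move=> C; apply: cvg_block_mx; try exact: cvg_cst_nbhs; exact: cvg_id.
- by exists 1%:M; rewrite /SL /= ?det1 // /diag1 (@scalar_mx_block _ 1 n).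
Qed.

End SpecialLinear.

(** * Symmetric matrices as A A^T *)

Section SymmetricSquareRoot.
Variable K : numClosedFieldType.

(* [sqrtC] itself is discontinuous at 1: it has its cut on the positive axis. *)
Lemma sqrt_near1 : exists s : K -> K,
  [/\ s 1 = 1, forall z, s z ^+ 2 = z & s z @[z --> (1 : K)] --> (1 : K)].
Proof.
(* Of the two roots, one that is nearest to 1 is chosen. *)
pose s (z : K) :=
  if `|sqrtC z - 1| <= `|sqrtC z + 1| then sqrtC z else - sqrtC z.
have sK z : s z ^+ 2 = z by rewrite /s; case: ifP; rewrite ?sqrrN sqrtCK.
have s_near z : `|s z - 1| <= `|s z + 1|.
  rewrite /s; case: ifPn => // nle.
  have : `|sqrtC z + 1| <= `|sqrtC z - 1|.
    by have := real_leVge (normr_real (sqrtC z - 1)) (normr_real (sqrtC z + 1));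
      rewrite (negPf nle).
  have -> : - sqrtC z - 1 = - (sqrtC z + 1) by ring.
  have -> : - sqrtC z + 1 = - (sqrtC z - 1) by ring.
  by rewrite !normrN.
(* As 2 <= |s z + 1| + |s z - 1| <= 2 |s z + 1|, the factor [s z + 1] of [z - 1] has norm at least
   1. *)
have s_lip z : `|s z - 1| <= `|z - 1|.
  have s1 : 1 <= `|s z + 1|.
    have n2 : (0 : K) < 2 by rewrite ltr0n.
    rewrite -(ler_pM2l n2) mulr1.
    have {1}-> : (2 : K) = `|(s z + 1) - (s z - 1)|.
      by rewrite (_ : _ - _ = 2) ?ger0_norm ?ler0n //; ring.
    apply: le_trans (ler_normB _ _) _.
    by rewrite mulr_natl mulr2n lerD2l.
  have -> : z - 1 = (s z - 1) * (s z + 1) by rewrite -{1}[z]sK; ring.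
  by rewrite normrM ler_peMr.
exists s; split=> //.
- apply/subr0_eq/eqP; rewrite -normr_le0.
  by apply: le_trans (s_lip 1) _; rewrite subrr normr0.
- move=> U /nbhs_ballP[e e0 eU]; apply/nbhs_ballP; exists e => // z.
  rewrite -ball_normE /= distrC => ze; apply: eU; rewrite -ball_normE /= distrC.
  exact: le_lt_trans (s_lip z) ze.
Qed.

(** One step of the block Cholesky decomposition: [B] is a root of the Schur complement of the pivot
    [s ^+ 2]. *)
Lemma cholesky_step n (s : K) (c : 'cV[K]_n) (D B : 'M[K]_n) : s != 0 ->
  B *m B^T = D - (s ^+ 2)^-1 *: (c *m c^T) ->
  let L := block_mx (s *: 1%:M) 0 (s^-1 *: c) B : 'M[K]_(1 + n) in
  L *m L^T = block_mx (s ^+ 2)%:M c^T c D.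
Proof.
move=> s0 BB L; rewrite /L tr_block_mx mulmx_block !trmx0 !mulmx0 !mul0mx !addr0.
rewrite !linearZ /= !trmx1 -!scalemxAl !mul1mx !mulmx1 !scalerA mulVf // mulfV //.
by rewrite !scale1r BB scalemx1 -expr2 -expr2 exprVn addrC subrK.
Qed.

(** Induction on the size: if [X] is nonzero, a congruence makes the corner nonzero and a Cholesky
    step splits it off. [X] may be singular. *)
Lemma sym_mulmx_tr n (X : 'M[K]_n) : X^T = X -> exists A : 'M[K]_n, X = A *m A^T.
Proof.
elim: n => [|n IHn] in X *.
  by move=> _; exists 0; rewrite [X]flatmx0 [RHS]flatmx0.
have unit_congr (Y P : 'M[K]_n.+1) : P \in unitmx ->
    (exists A : 'M[K]_n.+1, P *m Y *m P^T = A *m A^T) ->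
    exists A : 'M[K]_n.+1, Y = A *m A^T.
  move=> uP [A PYP]; exists (invmx P *m A).
  rewrite trmx_mul !mulmxA -[_ *m A *m A^T]mulmxA -PYP !mulmxA mulVmx // mul1mx.
  by rewrite -mulmxA -trmx_mul mulVmx // trmx1 mulmx1.
have corner (Y : 'M[K]_n.+1) : Y^T = Y -> Y 0 0 != 0 ->
    exists A : 'M[K]_n.+1, Y = A *m A^T.
  move=> sY Y00; pose Y' : 'M[K]_(1 + n) := Y.
  pose s := sqrtC (Y 0 0); pose c := dlsubmx Y'.
  have s0 : s != 0 by rewrite sqrtC_eq0.
  have [|B BB] := IHn (drsubmx Y' - (s ^+ 2)^-1 *: (c *m c^T)).
    rewrite linearB linearZ /= trmx_mul trmxK trmx_drsub.
    by rewrite (_ : Y'^T = Y').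
  exists (block_mx (s *: 1%:M) 0 (s^-1 *: c) B : 'M[K]_(1 + n)).
  rewrite (cholesky_step s0 (esym BB)) sqrtCK /c trmx_dlsub (_ : Y'^T = Y') //.
  rewrite -[LHS](@submxK _ 1 n 1 n) (_ : ulsubmx Y' = (Y 0 0)%:M) //.
  apply/matrixP => i j; rewrite !ord1 !mxE mulr1n.
  by congr (Y _ _); exact: val_inj.
have diag (Y : 'M[K]_n.+1) i : Y^T = Y -> Y i i != 0 ->
    exists A : 'M[K]_n.+1, Y = A *m A^T.
  move=> sY Yii; apply: (unit_congr _ (perm_mx (tperm 0 i))).
    exact: unitmx_perm.
  apply: corner; first by rewrite !trmx_mul trmxK sY mulmxA.
  by rewrite tr_perm_mx -col_permE -row_permE !mxE tpermL.
move=> sX; have [[i Xii]|X0] := pselect (exists i, X i i != 0).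
  exact: diag Xii.
have {}X0 i : X i i = 0.
  by apply/eqP/negPn/negP => Xii; apply: X0; exists i.
have [[i [j Xij]]|XN0] := pselect (exists i j, X i j != 0); last first.
  exists 0; rewrite mul0mx; apply/matrixP => i j; rewrite mxE.
  by apply/eqP/negPn/negP => Xij; apply: XN0; exists i, j.
have ij : i != j by apply: contraNneq Xij => ->; rewrite X0.
have dd0 : delta_mx i j *m delta_mx i j = 0 :> 'M[K]_n.+1.
  by rewrite mul_delta_mx_0 // eq_sym.
(* When the diagonal vanishes, congruence by this transvection puts [2 * X i j] on it. *)
have uP : (1%:M + delta_mx i j : 'M[K]_n.+1) \in unitmx.
  have /mulmx1_unit[] // : (1%:M + delta_mx i j) *m (1%:M - delta_mx i j) = 1%:M
    :> 'M[K]_n.+1.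
  by rewrite mulmxDl mul1mx mulmxBr mulmx1 dd0 subr0 subrK.
apply: (unit_congr _ _ uP).
apply: (diag _ i); first by rewrite !trmx_mul trmxK sX mulmxA.
have -> : ((1%:M + delta_mx i j) *m X *m (1%:M + delta_mx i j)^T) i i =
    2 * X i j.
  rewrite linearD /= trmx1 trmx_delta mulmxDl mul1mx mulmxDr mulmx1.
  have Xji : X j i = X i j by rewrite -[in LHS]sX mxE.
  have rowd (Y : 'M[K]_n.+1) k : (delta_mx i j *m Y) i k = Y j k.
    by rewrite mxE (bigD1 j) //= big1 ?addr0 ?mxE ?eqxx ?mul1r // => l lj;
      rewrite mxE (negPf lj) andbF mul0r.
  have cold (Y : 'M[K]_n.+1) k : (Y *m delta_mx j i) k i = Y k j.
    by rewrite mxE (bigD1 j) //= big1 ?addr0 ?mxE ?eqxx ?mulr1 // => l lj;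
      rewrite mxE (negPf lj) mulr0.
  have addE (Y Z : 'M[K]_n.+1) k l : (Y + Z) k l = Y k l + Z k l by rewrite mxE.
  by rewrite !addE cold !addE !rowd !X0 Xji; ring.
by rewrite mulf_neq0 // pnatr_eq0.
Qed.

(** The Cholesky recursion, run with a square root that is continuous at 1. Continuity at the
    identity is enough, because other base points are reached by congruence. *)
Lemma cholesky_near1 n : exists r : 'M[K]_n -> 'M[K]_n,
  [/\ r 1%:M = 1%:M, r Y @[Y --> (1%:M : 'M[K]_n)] --> (1%:M : 'M[K]_n) &
    \forall Y \near (1%:M : 'M[K]_n), Y^T = Y -> r Y *m (r Y)^T = Y].
Proof.
have [s [s1 sK cs]] := sqrt_near1.
elim: n => [|n [r [r1 cr rP]]].
  exists id; split=> //; near=> Y => _.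
  by rewrite [LHS]flatmx0 [RHS]flatmx0.
rewrite -[n.+1]/(1 + n)%N; pose a (Y : 'M[K]_(1 + n)) := ulsubmx Y 0 0.
pose c (Y : 'M[K]_(1 + n)) : 'cV[K]_n := dlsubmx Y.
(* The Schur complement of the corner; it tends to the identity with [Y], so the induction
   hypothesis applies to it. *)
pose D (Y : 'M[K]_(1 + n)) := drsubmx Y - (a Y)^-1 *: (c Y *m (c Y)^T).
pose R (Y : 'M[K]_(1 + n)) : 'M[K]_(1 + n) :=
  block_mx (s (a Y) *: 1%:M) 0 ((s (a Y))^-1 *: c Y) (r (D Y)).
have a1 : a 1%:M = 1 by rewrite /a (@scalar_mx_block _ 1 n) block_mxKul mxE.
have c1 : c 1%:M = 0 by rewrite /c (@scalar_mx_block _ 1 n) block_mxKdl.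
have D1 : D 1%:M = 1%:M.
  by rewrite /D a1 c1 (@scalar_mx_block _ 1 n) block_mxKdr mul0mx scaler0 subr0.
pose one : 'M[K]_(1 + n) := 1%:M.
have cul : ulsubmx Y @[Y --> one] --> ulsubmx one.
  rewrite ulsubmxEsub; under eq_fun do rewrite ulsubmxEsub.
  by apply: cvg_mxsub; exact: cvg_id.
have cdl : dlsubmx Y @[Y --> one] --> dlsubmx one.
  rewrite dlsubmxEsub; under eq_fun do rewrite dlsubmxEsub.
  by apply: cvg_mxsub; exact: cvg_id.
have cdr : drsubmx Y @[Y --> one] --> drsubmx one.
  rewrite drsubmxEsub; under eq_fun do rewrite drsubmxEsub.
  by apply: cvg_mxsub; exact: cvg_id.
have ca : a Y @[Y --> one] --> (1 : K) by rewrite -a1; exact: cvg_coord.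
have cc : c Y @[Y --> one] --> (0 : 'cV[K]_n) by rewrite -c1.
have cD : D Y @[Y --> one] --> (1%:M : 'M[K]_n).
  rewrite -D1; apply: cvg_sub_mx => //; apply: cvg_scale_mx.
    by apply: cvgV_nbhs; rewrite a1 ?oner_neq0.
  by apply: cvg_mulmx; rewrite ?c1 //; apply: cvg_trmx.
have csa : s (a Y) @[Y --> one] --> (1 : K) by exact: cvg_comp ca cs.
exists R; split.
- by rewrite /R a1 c1 D1 s1 r1 scaler0 scale1r (@scalar_mx_block _ 1 n).
- rewrite [X in _ --> X](@scalar_mx_block _ 1 n); apply: cvg_block_mx.
  + rewrite -[X in _ --> X]scale1r; apply: cvg_scale_mx => //.
    exact: cvg_cst_nbhs.
  + exact: cvg_cst_nbhs.
  + rewrite -[X in _ --> X](scaler0 _ 1^-1); apply: cvg_scale_mx => //.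
    by apply: cvgV_nbhs => //; exact: oner_neq0.
  + exact: cvg_comp cD cr.
- have near_sa : \forall Y \near one, s (a Y) != 0.
    exact: cvgr_neq0 csa (oner_neq0 _).
  have near_D : \forall Y \near one, (D Y)^T = D Y ->
      r (D Y) *m (r (D Y))^T = D Y.
    exact: cD rP.
  near=> Y => sY.
  have sa0 : s (a Y) != 0 by near: Y.
  have DY : r (D Y) *m (r (D Y))^T = D Y.
    have : (D Y)^T = D Y -> r (D Y) *m (r (D Y))^T = D Y by near: Y.
    apply; rewrite /D linearB linearZ /= trmx_mul trmxK trmx_drsub.
    by rewrite [X in drsubmx X]sY.
  rewrite /R (cholesky_step sa0 (D := drsubmx Y)); last by rewrite DY /D sK.
  rewrite sK /c trmx_dlsub [X in ursubmx X]sY -[RHS](@submxK _ 1 n 1 n).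
  congr block_mx; apply/matrixP => i j; rewrite !ord1.
  by rewrite [LHS]mxE mulr1n.
Unshelve. all: by end_near.
Qed.

(** Congruence by [invmx A] moves [A *m A^T] to the identity; the root found there, multiplied by
    [A] on the left, is close to [A]. *)
Lemma mulmx_tr_section n (A : 'M[K]_n) (V : set 'M[K]_n) :
  A \in unitmx -> nbhs A V ->
  \forall Y \near A *m A^T, Y^T = Y -> exists2 B, V B & Y = B *m B^T.
Proof.
move=> uA AV; have [r [r1 cr rP]] := cholesky_near1 n.
pose P := invmx A; pose h (Y : 'M[K]_n) := P *m Y *m P^T.
have hA : h (A *m A^T) = 1%:M.
  by rewrite /h !mulmxA mulVmx // mul1mx -trmx_mul mulVmx // trmx1.
have ch : h Y @[Y --> A *m A^T] --> (1%:M : 'M[K]_n).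
  rewrite -hA; apply: cvg_mulmx; last exact: cvg_cst_nbhs.
  by apply: cvg_mulmx; [exact: cvg_cst_nbhs | exact: cvg_id].
have cArh : A *m r (h Y) @[Y --> A *m A^T] --> A.
  rewrite -[X in _ --> X]mulmx1; apply: cvg_mulmx; first exact: cvg_cst_nbhs.
  exact: cvg_comp ch cr.
near=> Y => sY; exists (A *m r (h Y)); first by near: Y; exact: cArh AV.
have rhY : r (h Y) *m (r (h Y))^T = h Y.
  have : (h Y)^T = h Y -> r (h Y) *m (r (h Y))^T = h Y.
    by near: Y; exact: ch rP.
  by apply; rewrite /h !trmx_mul trmxK sY mulmxA.
rewrite trmx_mul !mulmxA -[A *m _ *m _]mulmxA rhY /h !mulmxA mulmxV // mul1mx.
by rewrite -mulmxA -trmx_mul mulmxV // trmx1 mulmx1.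
Unshelve. all: by end_near.
Qed.

End SymmetricSquareRoot.

(** * Topology of the orbit map *)

Section RhoTopology.
Import VectorInternalTheory.
Variable K : numFieldType.

Lemma f2mx_coord (f : 'End(J3 K)) i j : f2mx f i j =
  v2r (f (r2v (delta_mx 0 i))) 0 j.
Proof.
by rewrite unlock /= !r2vK -rowE mxE.
Qed.

Lemma rho_continuous : continuous (@rho K).
Proof.
apply: (@continuous_comp_initial _ _ _ (@f2mx K (J3 K) (J3 K))).
move=> A; apply: cvg_mx => i j.
(* For a fixed basis vector [X], the coefficients of [rho B] depend linearly on
   [B *m vsval X *m B^T]. *)
pose X := r2v (delta_mx 0 i) : J3 K.
have rhoX B : f2mx (rho B) i j =
    (v2r \o vsproj (symv K)) (B *m vsval X *m B^T) 0 j.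
  by rewrite f2mx_coord /rho lfunE.
have cX : B *m vsval X *m B^T @[B --> A] --> A *m vsval X *m A^T.
  apply: cvg_mulmx; last by apply: cvg_trmx; exact: cvg_id.
  by apply: cvg_mulmx; [exact: cvg_id | exact: cvg_cst_nbhs].
rewrite /= rhoX; under eq_fun do rewrite rhoX.
by apply: cvg_coord; apply: cvg_linear_mx cX => a U V; rewrite !linearP.
Qed.

Lemma eval_continuous (X : J3 K) :
  continuous (fun f : 'End(J3 K) => vsval (f X)).
Proof.
move=> f.
(* [g X] is a linear function of the coefficient matrix of [g]. *)
pose L (M : 'M[K]_(dim (J3 K))) : 'M[K]_3 :=
  vsval (r2v (v2r X *m M) : J3 K).
have LE (g : 'End(J3 K)) : vsval (g X) = L (f2mx g).
  by rewrite unlock.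
rewrite /continuous_at LE; under eq_fun do rewrite LE.
apply: cvg_linear_mx; last exact: initial_continuous.
by move=> a M N; rewrite /L !linearP.
Qed.

End RhoTopology.

(** * The orbit map at E: fibres, surjectivity, openness *)

Section OrbitMap.
Variable K : numClosedFieldType.

Lemma connected_E6 : connected [set: K] -> connected (E6 K).
Proof.
move=> cK; rewrite (_ : E6 K = @rho K @` @SL K 3).
  apply: connected_continuous_connected; first exact: connected_SL.
  by apply: continuous_subspaceT; exact: rho_continuous.
apply/seteqP; split=> [f /E6_SL3[A dA ->]|_ [A dA <-]]; first by exists A.
by apply: E6_rho; rewrite dA expr1n.
Qed.

Lemma EIV_orbit (a : E6 K) : EIV K (set_val a (J3E K)).
Proof.
have [_ da] := set_valP a.
by rewrite /EIV /= da /jdet vsval_J3E det1.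
Qed.

Definition orbit_map (a : E6 K) : EIV K := SigSub (mem_set (EIV_orbit a)).

Lemma orbit_map_continuous : continuous orbit_map.
Proof.
have c : continuous ((fun f : 'End(J3 K) => vsval (f (J3E K))) \o
    (set_val : E6 K -> 'End(J3 K))).
  move=> a; apply: continuous_comp; first exact: initial_continuous.
  exact: eval_continuous.
apply: (@continuous_comp_initial _ _ _ (@set_val _ (EIV K))).
by apply: (@continuous_comp_initial _ _ _ (@vsval _ _ (symv K))).
Qed.

Lemma coset_eq_orbit (a b : E6 K) :
  coset_eq a b = (orbit_map a == orbit_map b).
Proof.
have [ba da] := set_valP a; have [bb db] := set_valP b.
have aK := bij_lfunVK ba; have Ka := bij_lfunKV ba.
apply/asboolP/eqP => [[c Fc eb]|eab].
  by apply: val_inj; rewrite /= eb comp_lfunE (F4_J3E Fc).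
have {}eab : set_val a (J3E K) = set_val b (J3E K) by have := congr1 val eab.
(* The two elements differ by an element of E6 that fixes E, hence by one of F4. *)
exists ((set_val a)^-1 \o set_val b)%VF; last first.
  by apply/lfunP => X; rewrite !comp_lfunE Ka.
apply: E6_stab_F4; last by rewrite comp_lfunE -eab aK.
apply: E6_comp; last exact: set_valP.
split=> [|X]; first by exists (set_val a).
by rewrite -{2}(Ka X) da.
Qed.

Lemma orbit_map_surj (X : EIV K) : exists a, orbit_map a = X.
Proof.
have [A XA] := sym_mulmx_tr (tr_J3 (set_val X)).
have dA : \det A ^+ 2 = 1.
  have := set_valP X; rewrite /EIV /= /jdet XA det_mulmx det_tr => <-.
  by rewrite expr2.
exists (SigSub (mem_set (E6_rho dA))).
by apply: val_inj; apply: val_inj; rewrite /= rho_J3E -XA.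
Qed.

Local Notation Q := (E6modF4 K).
Local Open Scope quotient_scope.

Lemma pi_orbit (a b : E6 K) :
  (\pi_Q a == \pi_Q b) = (orbit_map a == orbit_map b).
Proof.
rewrite -coset_eq_orbit.
by apply/eqP/idP => /(@eqmodP _ (coset_eq_equivRel K)).
Qed.

(** This is openness of the orbit map, which makes the inverse bijection continuous. *)
Lemma orbit_map_section (a : E6 K) (U : set (E6 K)) : nbhs a U ->
  \forall X \near orbit_map a, exists2 b, U b & orbit_map b = X.
Proof.
move=> [_ [[W oW <-] /= Wa] WU].
have [A dA aA] : exists2 A, \det A = 1 & set_val a = rho A.
  exact: E6_SL3 (set_valP a).
have uA : A \in unitmx by rewrite unitmxE dA unitr1.
have AW : nbhs A (@rho K @^-1` W).
  by apply: rho_continuous; apply: open_nbhs_nbhs; rewrite -aA.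
have valE : continuous ((@vsval _ _ (symv K)) \o (set_val : EIV K -> J3 K)).
  move=> X; apply: continuous_comp; exact: initial_continuous.
have aE : A *m A^T = vsval (set_val (orbit_map a)) by rewrite -rho_J3E -aA.
have := mulmx_tr_section uA AW; rewrite aE => /(valE (orbit_map a)) sec_near.
near=> X.
have [|B WB XB] : (vsval (set_val X))^T = vsval (set_val X) ->
    exists2 B, W (rho B) & vsval (set_val X) = B *m B^T by near: X.
  exact: tr_J3.
have dB : \det B ^+ 2 = 1.
  have := set_valP X; rewrite /EIV /= /jdet XB det_mulmx det_tr => <-.
  by rewrite expr2.
exists (SigSub (mem_set (E6_rho dB))); first exact: WU.
by apply: val_inj; apply: val_inj; rewrite /= rho_J3E -XB.
Unshelve. all: by end_near.
Qed.

(** [s] itself need not be continuous: for [Y] near [X], [s Y] is replaced by an element of its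
    coset that is close to [s X]. *)
Lemma pi_section_continuous (s : EIV K -> E6 K) : cancel s orbit_map ->
  continuous (fun X => \pi_Q (s X)).
Proof.
move=> sK X U nU.
have nU' : nbhs (s X) (\pi_Q @^-1` U).
  exact: (@pi_continuous (E6 K) {eq_quot (@coset_eq K)} (s X) U nU).
have near_sec := orbit_map_section nU'; rewrite sK in near_sec.
have {near_sec} near_U : \forall Y \near X, U (\pi_Q (s Y)).
  near=> Y.
  have [b Ub bY] : exists2 b, (\pi_Q @^-1` U) b & orbit_map b = Y by near: Y.
  have e : \pi_Q (s Y) = \pi_Q b by apply/eqP; rewrite pi_orbit sK bY.
  by rewrite e.
exact: near_U.
Unshelve. all: by end_near.
Qed.

Lemma E6modF4_homeomorphic : homeomorphic Q (EIV K).
Proof.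
have [s sK] := choice orbit_map_surj.
have reprE a : orbit_map (repr (\pi_Q a)) = orbit_map a.
  by apply/eqP; rewrite -pi_orbit reprK.
exists (orbit_map \o repr), (fun X => \pi_Q (s X)); split.
- by move=> q; rewrite -[RHS]reprK; apply/eqP; rewrite pi_orbit sK.
- by move=> X; rewrite /= reprE sK.
- apply: repr_comp_continuous; first exact: orbit_map_continuous.
  by move=> a b; rewrite pi_orbit.
- exact: pi_section_continuous.
Qed.

End OrbitMap.

(** * Connectedness of the complex plane, and the conclusion *)

Lemma connected_complex (R : realType) : connected [set: (R[i] : numFieldType)].
Proof.
pose K : numFieldType := R[i].
pose line (z : K) (t : R) : K := t%:C%C * z.
have embed_continuous : continuous (fun t : R => t%:C%C : K).
  (* A positive element of [R[i]] is a positive real number, so the radius [e] has zero imaginary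
     part. *)
  move=> t U /nbhs_ballP[e]; rewrite /= ltcE /= => /andP[/eqP Ime e0] eU.
  apply/nbhs_ballP; exists (complex.Re e) => // u; rewrite -ball_normE /= => tu.
  apply: eU; rewrite -ball_normE /= -rmorphB /= normc_def /= expr0n addr0.
  by rewrite sqrtr_sqr ltcE /= Ime eqxx.
have line_continuous z : continuous (line z).
  move=> t; apply: cvgM; last exact: cvg_cst_nbhs.
  exact: embed_continuous.
(* The plane is star-shaped about 0: it is the union of the sets of real multiples of its points,
   which all contain 0. *)
have -> : [set: K] = \bigcup_(z in [set: K]) (line z @` [set: R]).
  apply/seteqP; split=> // z _; exists z => //.
  by exists 1 => //; rewrite /line mul1r.
apply: bigcup_connected => [|z _].
  by exists 0 => z _; exists 0 => //; rewrite /line mul0r.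
apply: connected_continuous_connected.
  by apply/connected_intervalP.
by apply: continuous_subspaceT; exact: line_continuous.
Qed.

Theorem proposition4p4 (R : realType) :
  homeomorphic (E6modF4 R[i]) (EIV R[i]) /\ connected (E6 R[i]).
Proof.
split; first exact: E6modF4_homeomorphic.
by apply: connected_E6; exact: connected_complex.
Qed.
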